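(* Let $G$ be a group generated by a bounded automaton. Then $\mathrm{WP}_G\in\mathrm{DTIME}_*(n\log n)$.
   Context: An automaton over a finite alphabet $X$ is $A=(S,X,t,o)$ with finite state set $S$, transition map $t:S\times X\to S$, output map $o:S\times X\to X$, extended to words by $t(s,xv)=t(t(s,x),v)$, $o(s,xv)=o(s,x)o(t(s,x),v)$. It is assumed invertible (each $o(s,\cdot)$ permutes $X$), minimal (distinct states define distinct transformations of $X^{*}$), with $S$ closed under inversion; the group it generates is the group of transformations $o(s,\cdot)$ of $X^{*}$. For $s\in S$ and $v\in X^{*}$, $s|_v=t(s,v)$. The trivial state $e$ is the state acting as the identity. The automaton is bounded if there is a constant $C$ such that for every $s\in S$ and $n\in\mathbb{N}$ there are at most $C$ words $v\in X^n$ with $s|_v\neq e$. $\mathrm{WP}_G=\{w\in S^{*}: w=_Ge\}$. $\mathrm{DTIME}_*(t(n))$ is the class of languages decided in time $O(t(n))$ by a deterministic multi-tape Turing machine. *)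

(* Defs.v *)
From HB Require Import structures.
From mathcomp Require Import all_boot all_order all_algebra.
Set Implicit Arguments. Unset Strict Implicit. Unset Printing Implicit Defensive.
Import GRing.Theory Num.Theory.

Record automaton (S X : finType) := Automaton {
  trans : S -> X -> S;
  outp  : S -> X -> X
}.

Section AutomatonDefs.
Variables (S X : finType) (A : automaton S X).

Fixpoint out (s : S) (v : seq X) : seq X :=
  match v with
  | [::] => [::]
  | x :: v' => outp A s x :: out (trans A s x) v'
  end.

Fixpoint restr (s : S) (v : seq X) : S :=
  match v with
  | [::] => s
  | x :: v' => restr (trans A s x) v'
  end.

Definition trivial_state (s : S) : Prop := forall u : seq X, out s u = u.

Definition invertible_aut : Prop := forall s : S, injective (outp A s).

Definition minimal_aut : Prop :=
  forall s1 s2 : S, (forall u : seq X, out s1 u = out s2 u) -> s1 = s2.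

Definition inverse_closed_aut : Prop :=
  forall s : S, exists s' : S,
    (forall u : seq X, out s' (out s u) = u) /\
    (forall u : seq X, out s (out s' u) = u).

(* bounded: exists C, for all s and n, at most C words v of length n with
   s|_v <> e (i.e. s|_v acting nontrivially). Stated without decidability:
   every duplicate-free list of such words has length <= C. *)
Definition bounded_aut : Prop :=
  exists C : nat, forall (s : S) (n : nat) (vs : seq (seq X)),
    uniq vs ->
    (forall v, v \in vs -> size v = n /\ ~ trivial_state (restr s v)) ->
    size vs <= C.

(* The element of G represented by a word w = s_1 ... s_m over S:
   the transformation u |-> o(s_m, ... o(s_2, o(s_1, u)) ...). *)
Definition act_word (w : seq S) (u : seq X) : seq X :=
  foldl (fun u' s => out s u') u w.

Definition WP (w : seq S) : Prop := forall u : seq X, act_word w u = u.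

End AutomatonDefs.

Inductive move := MoveL | MoveN | MoveR.

(* A deterministic Turing machine with k.+1 bi-infinite tapes, input alphabet
   Sigma, state set Q and tape alphabet G. Tape 0 holds the input. *)
Record TM (Sigma Q G : finType) (k : nat) := MkTM {
  tm_blank : G;
  tm_inp : Sigma -> G;
  tm_q0 : Q;
  tm_halt : pred Q;
  tm_acc : pred Q;
  tm_delta : Q -> {ffun 'I_k.+1 -> G} ->
             Q * {ffun 'I_k.+1 -> G} * {ffun 'I_k.+1 -> move}
}.

Section TMDefs.
Variables (Sigma Q G : finType) (k : nat) (M : TM Sigma Q G k).

Definition TM_wf : Prop :=
  injective (tm_inp M) /\ forall a, tm_inp M a != tm_blank M.

Record config := Config {
  cfg_state : Q;
  cfg_tape : 'I_k.+1 -> int -> G;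
  cfg_head : 'I_k.+1 -> int
}.

Definition move_shift (m : move) : int :=
  match m with MoveL => (-1)%R | MoveN => 0%R | MoveR => 1%R end.

Definition tm_step (c : config) : config :=
  if tm_halt M (cfg_state c) then c else
  let read := [ffun i => cfg_tape c i (cfg_head c i)] in
  let '(q', wr, mv) := tm_delta M (cfg_state c) read in
  Config q'
    (fun i z => if z == cfg_head c i then wr i else cfg_tape c i z)
    (fun i => (cfg_head c i + move_shift (mv i))%R).

Definition tm_init (w : seq Sigma) : config :=
  Config (tm_q0 M)
    (fun i z =>
       if i == ord0 then
         match z with
         | Posz n => nth (tm_blank M) (map (tm_inp M) w) n
         | Negz _ => tm_blank M
         end
       else tm_blank M)
    (fun _ => 0%R).

Definition tm_run (n : nat) (c : config) : config := iter n tm_step c.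

Definition decides_in_time (T : nat -> nat) (L : seq Sigma -> Prop) : Prop :=
  forall w : seq Sigma, exists m : nat,
    m <= T (size w) /\
    tm_halt M (cfg_state (tm_run m (tm_init w))) /\
    (tm_acc M (cfg_state (tm_run m (tm_init w))) <-> L w).

End TMDefs.

Definition DTIME_star (Sigma : finType) (t : nat -> nat)
    (L : seq Sigma -> Prop) : Prop :=
  exists (Q G : finType) (k : nat) (M : TM Sigma Q G k) (c : nat),
    TM_wf M /\ decides_in_time M (fun n => c * t n + c) L.

Definition nlogn (n : nat) : nat := n * trunc_log 2 n.

(* Main.v *)
(** Contraction. After passing to blocks of m letters, every section of a
    generator is either finitary (trivial below the next block) or spinal: it
    reproduces itself along one block and is finitary along all others.  If two
    consecutive spinal factors of a word survive two blocks, they follow the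
    same spine and their product is again spinal; hence two blocks halve the
    number of spinal factors, and a word of length n that acts nontrivially
    already moves a word of length O(log n).

    Algorithm. Keep the list of all nonempty sections of the input word on the
    current level, with trivial letters deleted.  Boundedness and the injectivity
    of the action make the total length of each such list O(n), and a level is
    processed by a constant number of linear scans.  The input tape serves as a
    counter for the O(log n) levels: each round kills every other live cell.
    Replacing X by X^D makes one level per halving sufficient. *)
Require Import Defs.
From Stdlib Require Import Classical ClassicalEpsilon.
From HB Require Import structures.
From mathcomp Require Import all_boot all_order all_algebra.
From mathcomp Require Import zify.
Set Implicit Arguments. Unset Strict Implicit. Unset Printing Implicit Defensive.

(** * Sections of words and contraction *)

Section WordSections.
Variables (S X : finType) (A : automaton S X).
Implicit Types (s : S) (x : X) (u v : seq X) (w h b : seq S).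

Notation act := (act_word A).

Lemma size_out s u : size (out A s u) = size u.
Proof. by elim: u s => //= x u IH s; rewrite IH. Qed.

Lemma out_cat s v u : out A s (v ++ u) = out A s v ++ out A (restr A s v) u.
Proof. by elim: v s => //= x v IH s; rewrite IH. Qed.

Lemma restr_cat s v u : restr A s (v ++ u) = restr A (restr A s v) u.
Proof. by elim: v s => /=. Qed.

Lemma out_inj s : invertible_aut A -> injective (out A s).
Proof.
move=> inv u; elim: u s => [|x u IH] s [|y v] //= [/inv xy].
by rewrite xy => /IH ->.
Qed.

(** Each letter is restricted at the image of [v] under the letters before it. Trivial letters are
    kept, so the length is preserved; [nsec] is the one-letter variant that deletes them. *)
Fixpoint secw v w : seq S :=
  if w is s :: w' then restr A s v :: secw (out A s v) w' else [::].

Lemma act_catw w w' u : act (w ++ w') u = act w' (act w u).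
Proof. by rewrite /act_word foldl_cat. Qed.

Lemma size_act w u : size (act w u) = size u.
Proof. by elim: w u => //= s w IH u; rewrite IH size_out. Qed.

Lemma act_nil w : act w [::] = [::].
Proof. by apply/size0nil; rewrite size_act. Qed.

Lemma act_cat w v u : act w (v ++ u) = act w v ++ act (secw v w) u.
Proof. by elim: w v u => //= s w IH v u; rewrite out_cat IH. Qed.

Lemma secw_catw v w w' : secw v (w ++ w') = secw v w ++ secw (act w v) w'.
Proof. by elim: w v => //= s w IH v; rewrite IH. Qed.

Lemma secw_cat v u w : secw (v ++ u) w = secw u (secw v w).
Proof. by elim: w v u => //= s w IH v u; rewrite restr_cat out_cat IH. Qed.

Lemma act_inj w : invertible_aut A -> injective (act w).
Proof. by move=> inv; elim: w => [|s w IH] u v //= /IH /out_inj; apply. Qed.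

(** Actions preserve length, so equal images split at the same place: sections depend only on the
    transformation, and words may be replaced by equivalent ones. *)
Lemma eq_act_secw v w w' : act w =1 act w' -> act (secw v w) =1 act (secw v w').
Proof.
move=> e u; have := e (v ++ u); rewrite !act_cat => /eqP.
by rewrite eqseq_cat ?size_act // => /andP[_ /eqP].
Qed.

Lemma eq_act_cat w1 w1' w2 w2' :
  act w1 =1 act w1' -> act w2 =1 act w2' -> act (w1 ++ w2) =1 act (w1' ++ w2').
Proof. by move=> e1 e2 u; rewrite !act_catw e1 e2. Qed.

Definition fixes_upto k w := forall u, size u <= k -> act w u = u.

Lemma fixes_upto_secw k l v w :
  size v + k <= l -> fixes_upto l w -> fixes_upto k (secw v w).
Proof.
move=> le fw u su; have := fw (v ++ u); rewrite size_cat act_cat.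
move=> /(_ ltac:(lia)) /eqP.
by rewrite eqseq_cat ?size_act // => /andP[_ /eqP].
Qed.

Lemma WP_of_secm m w : fixes_upto m w ->
  (forall v, size v = m -> WP A (secw v w)) -> WP A w.
Proof.
move=> fw sw u; have [le|lt] := leqP (size u) m; first exact: fw.
have st : size (take m u) = m by rewrite size_takel // ltnW.
by rewrite -{1}(cat_take_drop m u) act_cat fw ?st // sw // cat_take_drop.
Qed.

Lemma size_secw v w : size (secw v w) = size w.
Proof. by elim: w v => //= s w IH v; rewrite IH. Qed.

Lemma mem_secw v w s :
  s \in secw v w -> exists s0 v0, size v0 = size v /\ s = restr A s0 v0.
Proof.
elim: w v => //= s0 w IH v; rewrite inE => /orP[/eqP->|/IH]; first by exists s0, v.
by rewrite size_out.
Qed.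

(** * Finitary and spinal words over blocks of length m *)

Section Contraction.
Variable m : nat.

Definition finitary_word h := forall u, size u = m -> act (secw u h) =1 id.

(** Along the spine [b] recurs only as a transformation, not as a word, so that a product of spinal
    words can again be spinal. *)
Definition spinal_word b v := [/\ size v = m, act (secw v b) =1 act b &
  forall u, size u = m -> u <> v -> finitary_word (secw u b)].

(* [spinal_length N w]: [w] acts as a product h0 b1 h1 ... bn hn of finitary
   words hi and spinal words bi, with n <= N. *)
Fixpoint spinal_length N w : Prop :=
  finitary_word w \/
  if N is N'.+1 then exists h b v w', [/\ act w =1 act (h ++ b ++ w'),
    finitary_word h, spinal_word b v & spinal_length N' w'] else False.

Lemma eq_finitary w w' : act w =1 act w' -> finitary_word w -> finitary_word w'.
Proof. by move=> e fw u su y; rewrite -(eq_act_secw u e) fw. Qed.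

Lemma finitary_cat h h' :
  finitary_word h -> finitary_word h' -> finitary_word (h ++ h').
Proof.
move=> fh fh' u su y; rewrite secw_catw act_catw fh // fh' //.
by rewrite size_act.
Qed.

Lemma finitary_id w : act w =1 id -> finitary_word w.
Proof. by move=> e; apply: (@eq_finitary [::]). Qed.

Lemma eq_spinal_length N w w' :
  act w =1 act w' -> spinal_length N w -> spinal_length N w'.
Proof.
case: N => [|N] e [fw|] //; try by left; apply: eq_finitary fw.
move=> [h [b [v [w0 [e0 fh sb sl]]]]]; right; exists h, b, v, w0.
by split=> // u; rewrite -e.
Qed.

Lemma finitary_length N h : finitary_word h -> spinal_length N h.
Proof. by case: N => /=; left. Qed.

Lemma finitary_cat_length N h w :
  finitary_word h -> spinal_length N w -> spinal_length N (h ++ w).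
Proof.
case: N => [|N] fh [fw|] //; try by left; apply: finitary_cat.
move=> [h0 [b [v [w0 [e0 fh0 sb sl]]]]]; right; exists (h ++ h0), b, v, w0.
by split=> //; [move=> u; rewrite -catA !(act_catw h) e0 | apply: finitary_cat].
Qed.

Lemma spinal_length_cat N N' w w' :
  spinal_length N w -> spinal_length N' w' -> spinal_length (N + N') (w ++ w').
Proof.
move=> + sl'; elim: N w => [|N IH] w.
  by case=> // fw; apply: finitary_cat_length.
have mono M w1 : spinal_length M w1 -> spinal_length M.+1 w1.
  elim: M w1 => [|M IHM] w1 [fw|] //=; try by left.
  case=> [h [b [v [w0 [e0 fh sb sl]]]]]; right; exists h, b, v, w0.
  by split=> //; apply: IHM.
case=> [fw|[h [b [v [w0 [e0 fh sb sl]]]]]].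
  rewrite addSn; apply/mono/IH; exact: finitary_length.
right; exists h, b, v, (w0 ++ w'); split=> //; last exact: IH.
by move=> u; rewrite act_catw e0 -!act_catw -!catA.
Qed.

Lemma spinal_length1 b v : spinal_word b v -> spinal_length 1 b.
Proof.
move=> sb; right; exists [::], b, v, [::]; rewrite /= cats0.
by split=> //; left.
Qed.

Lemma spinal_secw b v u : spinal_word b v -> size u = m ->
  u = v /\ act (secw u b) =1 act b \/ u <> v /\ finitary_word (secw u b).
Proof.
by case=> sv e f su; have [->|/eqP ne] := eqVneq u v; [left|right; split=> //; exact: f].
Qed.

Lemma secw_spinal_length N w u :
  size u = m -> spinal_length N w -> spinal_length N (secw u w).
Proof.
elim: N w u => [|N IH] w u su [fw|] //=; try by left; apply/finitary_id/fw.
case=> [h [b [v [w0 [e0 fh sb sl]]]]].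
apply: (@eq_spinal_length N.+1 (secw u (h ++ b ++ w0))).
  by apply: eq_act_secw => y; rewrite e0.
rewrite !secw_catw; apply: finitary_cat_length; first exact/finitary_id/fh.
rewrite -[N.+1]/(1 + N)%N; apply: spinal_length_cat; last by apply: IH; rewrite ?size_act.
set u' := act h u; have su' : size u' = m by rewrite size_act.
have [[_ e]|[_ f]] := spinal_secw sb su'; last exact: finitary_length.
by apply: (@eq_spinal_length 1 b) => [y|]; [rewrite e | exact: spinal_length1 sb].
Qed.

(* Two spinal words that are both still present after one block of m letters
   are by then adjacent; after the second block they have either separated or
   lie on a common spine, in which case their product is again spinal. *)
Lemma secw2_spinal_pair b v b' v' u1 u2 : invertible_aut A ->
  spinal_word b v -> spinal_word b' v' -> size u1 = m -> size u2 = m ->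
  forall h, finitary_word h -> spinal_length 1 (secw (u1 ++ u2) (b ++ h ++ b')).
Proof.
move=> inv sb sb' s1 s2 h fh; rewrite secw_cat !secw_catw.
set c := secw u1 b; set c' := secw _ b'; set k := secw _ h.
have s1' : size (act h (act b u1)) = m by rewrite !size_act.
(* The finitary word in the middle dies in the first block, which leaves the two outer sections
   adjacent. *)
have k1 : act k =1 id by apply: fh; rewrite size_act.
have one d y z : spinal_word d y -> size z = m -> spinal_length 1 (secw z d).
  by move=> sd sz; apply: secw_spinal_length sz (spinal_length1 sd).
have key : act (secw u2 (c ++ k ++ c')) =1 act (secw u2 (c ++ c')).
  by apply: eq_act_secw => y; rewrite !act_catw k1.
apply: (@eq_spinal_length 1 (secw u2 (c ++ c'))); first by move=> y; rewrite -key !secw_catw.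
have [[_ ec]|[_ fc]] := spinal_secw sb s1; last first.
  rewrite secw_catw; apply: finitary_cat_length; first exact/finitary_id/fc.
  apply: secw_spinal_length; first by rewrite size_act.
  exact: secw_spinal_length s1' (spinal_length1 sb').
have [[_ ec']|[_ fc']] := spinal_secw sb' s1'; last first.
  rewrite secw_catw -[1]/(1 + 0)%N; apply: spinal_length_cat.
    apply: secw_spinal_length => //; exact: secw_spinal_length s1 (spinal_length1 sb).
  by apply/finitary_length/finitary_id/fc'; rewrite size_act.
apply: (@eq_spinal_length 1 (secw u2 (b ++ b'))).
  by apply: eq_act_secw => y; rewrite !act_catw -ec -ec'.
have s2' : size (act b u2) = m by rewrite size_act.
rewrite secw_catw.
have [[e2 a]|[_ f]] := spinal_secw sb s2; last first.
  by apply: finitary_cat_length => //; apply: one sb' _.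
have [[e2' a']|[_ f']] := spinal_secw sb' s2'; last first.
  by rewrite -[1]/(1 + 0)%N; apply: spinal_length_cat; [apply: one sb _ | left].
apply: (@eq_spinal_length 1 (b ++ b')).
  by apply: eq_act_cat => y; rewrite ?a ?a'.
(* Here [u2 = v] and [act b v = v'], so the product has spine [v]. *)
apply: (@spinal_length1 _ v); case: sb sb' => sv eb fb [sv' eb' fb'].
split=> //.
  by rewrite secw_catw -e2 e2' -e2'; apply: eq_act_cat => y; rewrite ?a ?a'.
(* Off [v], injectivity of the action keeps the second factor off [v'], so both sections are
   finitary. *)
move=> z sz zv; rewrite secw_catw; apply: finitary_cat; first exact: fb.
apply: fb'; rewrite ?size_act // -e2' => /act_inj zu; apply: zv.
by rewrite zu.
Qed.

(** Consecutive spinal factors are paired from the left, each pair contracting to at most one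
    factor; an unpaired last factor survives, hence [uphalf]. *)
Lemma secw2_spinal_length N w u1 u2 : invertible_aut A ->
  size u1 = m -> size u2 = m ->
  spinal_length N w -> spinal_length (uphalf N) (secw (u1 ++ u2) w).
Proof.
move=> inv; elim/ltn_ind: N w u1 u2 => -[|[|N]] IH w u1 u2 s1 s2 sl;
  try by rewrite secw_cat; do 2 apply: secw_spinal_length => //.
have fin w1 : finitary_word w1 -> finitary_word (secw (u1 ++ u2) w1).
  by move=> fw1; rewrite secw_cat; apply/finitary_id => y;
     rewrite (@eq_act_secw u2 _ [::] (fw1 _ s1)).
case: sl => [fw|]; first exact/finitary_length/fin.
case=> [h [b [v [w0 [e0 fh sb sl]]]]].
apply: (@eq_spinal_length _ (secw (u1 ++ u2) (h ++ b ++ w0))).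
  by apply: eq_act_secw => y; rewrite e0.
rewrite secw_catw; apply: finitary_cat_length; first exact: fin.
set u := act h _.
have [t1 [t2 [eu r1 r2]]] : exists t1 t2, [/\ u = t1 ++ t2, size t1 = m & size t2 = m].
  have su : size u = m + m by rewrite size_act size_cat s1 s2.
  exists (take m u), (drop m u).
  by rewrite cat_take_drop size_takel ?size_drop su ?leq_addr ?addKn.
rewrite {u}eu [uphalf _]/=; case: sl => [fw|[h' [b' [v' [w' [e' fh' sb' sl']]]]]].
  rewrite secw_catw -[_.+1]/(1 + _); apply: spinal_length_cat.
    rewrite secw_cat; do 2 apply: secw_spinal_length => //.
    exact: spinal_length1 sb.
  apply: finitary_length; set u := act b _.
  rewrite -(cat_take_drop m u) secw_cat; apply: finitary_id => y.
  have su : size u = m + m by rewrite size_act size_cat r1 r2.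
  by rewrite (@eq_act_secw _ _ [::] (fw _ _)) // size_takel // su leq_addr.
apply: (@eq_spinal_length _ (secw (t1 ++ t2) ((b ++ h' ++ b') ++ w'))).
  by apply: eq_act_secw => y; rewrite -!catA !(act_catw b) -e'.
rewrite secw_catw -[_.+1]/(1 + _); apply: spinal_length_cat.
  exact: secw2_spinal_pair sb sb' _ _ _ fh'.
set u := act _ _; have su : size u = m + m by rewrite size_act size_cat r1 r2.
rewrite -(cat_take_drop m u); apply: IH sl' => //.
  by rewrite size_takel // su leq_addr.
by rewrite size_drop su addKn.
Qed.

Lemma finitary_WP h : finitary_word h -> fixes_upto m h -> WP A h.
Proof. by move=> fh fx; apply: (@WP_of_secm m _ fx) => v sv u; apply: fh. Qed.

(** Induction on the length of the argument: a block equal to [v] leaves [b] itself acting on a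
    shorter rest, any other block leaves a finitary word. One block of depth tests the step, the
    second tests that finitary word. *)
Lemma spinal_WP b v : 0 < m -> spinal_word b v -> fixes_upto (m + m) b -> WP A b.
Proof.
move=> m0 [sv e f] fx u; elim/ltn_ind: {u}(size u) {-2}u (erefl (size u)) => n IH u su.
have [le|lt] := leqP n m; first by apply: fx; lia.
have st : size (take m u) = m by rewrite size_takel // su ltnW.
rewrite -{1}(cat_take_drop m u) act_cat fx ?st ?leq_addr //.
have [tv|/eqP tv] := eqVneq (take m u) v.
  rewrite tv e (IH (n - m)) ?size_drop ?su //; last by lia.
  by rewrite -{1}tv cat_take_drop.
rewrite (finitary_WP (f _ st tv)) ?cat_take_drop //.
by apply: fixes_upto_secw fx; rewrite st.
Qed.

(** Each of the [j] halvings costs two blocks. At most one spinal factor then remains: one block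
    removes the finitary words around it, and [spinal_WP] needs two more. *)
Lemma spinal_length_WP N w j : invertible_aut A -> 0 < m ->
  spinal_length N w -> N <= 2 ^ j -> fixes_upto ((m + m) * j + (m + m + m)) w ->
  WP A w.
Proof.
move=> inv m0; elim: j N w => [|j IH] N w sl le fx; last first.
  apply: (@WP_of_secm (m + m)) => [u su|v sv].
    by apply: fx; lia.
  apply: (IH (uphalf N)); last first.
  - by apply: fixes_upto_secw fx; rewrite sv; lia.
  - by move: le; rewrite expnS; lia.
  rewrite -(cat_take_drop m v); apply: secw2_spinal_length => //.
    by rewrite size_takel // sv leq_addr.
  by rewrite size_drop sv addKn.
have {}fx : fixes_upto (m + m + m) w by rewrite muln0 add0n in fx.
have fin : finitary_word w -> WP A w.
  by move=> fw; apply: finitary_WP => // u su; apply: fx; lia.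
case: N le sl => [|[|//]] _ [] // [h [b [v [w' [e fh sb [fw'|//]]]]]].
apply: (@WP_of_secm m) => [u su|u su]; first by apply: fx; lia.
have eb : act (secw u w) =1 act (secw (act h u) b).
  move=> y; rewrite (eq_act_secw u e) !secw_catw !act_catw fh // fw' //.
  by rewrite !size_act.
have {}fx : fixes_upto (m + m) (secw (act h u) b).
  by move=> y sy; rewrite -eb; apply: (fixes_upto_secw _ fx) sy; rewrite su; lia.
move=> y; rewrite eb.
have [[_ e1]|[_ f1]] := spinal_secw sb (etrans (size_act h u) su).
  rewrite e1; apply: (spinal_WP m0 sb) => z sz; rewrite -e1; exact: fx.
by apply: (finitary_WP f1) => z sz; apply: fx; lia.
Qed.

Lemma letters_spinal_length w :
  (forall s, s \in w -> finitary_word [:: s] \/ exists v, spinal_word [:: s] v) ->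
  spinal_length (size w) w.
Proof.
elim: w => [|s w IH] H; first by left.
rewrite -cat1s -[size _]/(1 + size w); apply: spinal_length_cat.
  by case: (H s (mem_head _ _)) => [/finitary_length //|[v /spinal_length1]].
by apply: IH => s' s'w; apply: H; rewrite inE s'w orbT.
Qed.

End Contraction.
End WordSections.

(** * Boundedness and the detection depth *)

(** Turns triviality of states into a boolean test, so that words can be counted and the test can
    enter a transition table. *)
Lemma classical_pred (T : Type) (P : T -> Prop) :
  exists p : pred T, forall x, p x <-> P x.
Proof.
exists (fun x => if excluded_middle_informative (P x) then true else false) => x.
by case: excluded_middle_informative.
Qed.

Lemma finite_max (T : finType) (P : T -> nat -> Prop) :
  (forall x, exists n, P x n) -> (forall x n n', n <= n' -> P x n -> P x n') ->
  exists n, forall x, P x n.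
Proof.
move=> ex mono.
have [f fP] := choice P ex; exists (\max_x f x) => x.
exact: mono (leq_bigmax x) (fP x).
Qed.

(** Induction on the room [C - f 0]: if some value exceeds the first one, restart there with less
    room; otherwise the function is constant. *)
Lemma bounded_nondecreasing_stable (f : nat -> nat) C :
  (forall n, f n <= f n.+1) -> (forall n, f n <= C) ->
  exists n0, forall n, n0 <= n -> f n = f n0.
Proof.
move=> mono bd.
have {}mono i j : i <= j -> f i <= f j.
  by move=> /subnK <-; elim: (j - i) => // d IH; apply: leq_trans IH (mono _).
have [k] := ubnP (C - f 0); elim: k (f) mono bd => // k IH g mono bd lt.
have [[i lti]|no] := excluded_middle_informative (exists i, g 0 < g i).
  have [|||n0 n0P] := IH (fun n => g (i + n)).
  - by move=> a b ab; apply: mono; rewrite leq_add2l.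
  - by [].
  - by rewrite addn0; have := bd i; have := bd 0; lia.
  exists (i + n0) => n le; have -> : n = i + (n - i) by lia.
  by apply: n0P; lia.
exists 0 => n _; apply/eqP; rewrite eqn_leq (mono 0 n) // andbT leqNgt.
by apply/negP => lt0; apply: no; exists n.
Qed.

(** After at most [#|T|] steps the orbit is on a cycle, whose length is at most [#|T|] and so
    divides the factorial. *)
Lemma iter_fact_periodic (T : finType) (f : T -> T) k x :
  #|T| <= k -> iter (#|T|)`! f (iter k f x) = iter k f x.
Proof.
move=> le.
have /trajectP[i lti ei] : looping f x (fingraph.order f x) by apply: looping_order.
set o := fingraph.order f x in lti ei.
have oT : o <= #|T| by apply: max_card.
have per q j : i <= j -> iter (q * (o - i)) f (iter j f x) = iter j f x.
  move=> ij; elim: q => // q IH; rewrite mulSn iterD IH -iterD.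
  have -> : o - i + j = (j - i) + o by lia.
  by rewrite iterD ei -iterD subnK.
have /dvdnP[q ->] : o - i %| (#|T|)`! by apply: dvdn_fact; lia.
by apply: per; lia.
Qed.

(** * Counting the words that lead to a given set of states *)

Section Counting.
Variables (S X : finType) (A : automaton S X).
Implicit Types (s : S) (x : X) (u v : seq X).

Notation act := (act_word A).

Lemma trivial_trans s x : trivial_state A s -> trivial_state A (trans A s x).
Proof. by move=> ts u; have := ts (x :: u) => /= -[_]. Qed.

Lemma trivial_restr s v : trivial_state A s -> trivial_state A (restr A s v).
Proof. by elim: v s => //= x v IH s ts; apply/IH/trivial_trans. Qed.

Section Predicate.
Variable p : pred S.

(** An explicit duplicate-free list, the form in which [bounded_aut] bounds the number of such
    words. *)
Fixpoint words_to k s : seq (seq X) :=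
  if k is k'.+1 then [seq x :: v | x <- enum X, v <- words_to k' (trans A s x)]
  else if p s then [:: [::]] else [::].

Definition count_to k s := size (words_to k s).

Lemma count_to0 s : count_to 0 s = p s.
Proof. by rewrite /count_to /=; case: (p s). Qed.

Lemma count_toS k s : count_to k.+1 s = \sum_x count_to k (trans A s x).
Proof. by rewrite /count_to /= size_allpairs_dep sumnE big_map big_enum. Qed.

Lemma uniq_words_to k s : uniq (words_to k s).
Proof.
elim: k s => [|k IH] s /=; first by case: ifP.
by apply: allpairs_uniq_dep => [|x _|[x u] [y v] _ _ /= [-> ->]]; rewrite ?enum_uniq.
Qed.

Lemma words_toP k s v : v \in words_to k s -> size v = k /\ p (restr A s v).
Proof.
elim: k s v => [|k IH] s v /=.
  by case: ifP => // ps; rewrite inE => /eqP ->.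
by case/allpairsPdep => x [u [_ /IH[<- pu] ->]].
Qed.

Lemma count_to_bounded C :
  (forall s n (vs : seq (seq X)), uniq vs ->
    (forall v, v \in vs -> size v = n /\ p (restr A s v)) -> size vs <= C) ->
  forall s n, count_to n s <= C.
Proof. by move=> bd s n; apply: (bd s n); [exact: uniq_words_to | exact: words_toP]. Qed.

Section Persistent.
Hypothesis p_child : forall s, p s -> exists x, p (trans A s x).

Lemma count_to_mono k s : count_to k s <= count_to k.+1 s.
Proof.
elim: k s => [|k IH] s; last by rewrite !(count_toS _ s); apply: leq_sum.
rewrite count_to0 count_toS; case ps: (p s) => //.
by have [x px] := p_child ps; rewrite (bigD1 x) //= count_to0 px.
Qed.

(** A stable state satisfying [p] has exactly one word of each length leading to [p]: its spine. *)
Definition stable s := forall k, count_to k s = p s.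

(** A count is the sum of the counts at the children, each nondecreasing in depth; if the sum is
    constant, so is every summand. *)
Lemma stable_restr n s v : (forall k, count_to (k + n) s = count_to n s) ->
  size v = n -> stable (restr A s v).
Proof.
elim: n s v => [|n IH] s [|x v] //= cs.
  by move=> _ k; rewrite -(addn0 k) cs count_to0.
move=> [sv]; apply: IH => // k; apply/eqP.
have mono j s' : count_to n s' <= count_to (j + n) s'.
  by elim: j => // j IHj; apply: leq_trans IHj (count_to_mono _ _).
have /leqif_sum[_ eq_sum] : forall y : X, xpredT y ->
    count_to n (trans A s y) <= count_to (k + n) (trans A s y)
      ?= iff (count_to n (trans A s y) == count_to (k + n) (trans A s y)).
  by move=> y _; split.
move: (cs k); rewrite addnS !count_toS => /esym/eqP; rewrite eq_sum.
by move/forall_inP/(_ x isT); rewrite eq_sym.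
Qed.

Lemma stable_trans s x : stable s -> stable (trans A s x).
Proof. by move=> ss; apply: (@stable_restr 1 _ [:: x]) => // k; rewrite !ss. Qed.

Lemma stable_child s x y : stable s -> p s ->
  p (trans A s x) -> p (trans A s y) -> x = y.
Proof.
move=> ss ps px py; apply/eqP/negPn/negP => xy; have := ss 1.
rewrite count_toS ps (bigD1 x) //= (bigD1 y) 1?eq_sym //= !count_to0 px py.
by rewrite addnA.
Qed.

(** Following the spine becomes iteration of a self-map of the finite set [S], hence eventually
    periodic. The value [s] is a mere default when no child satisfies [p]. *)
Definition spine_next s := if [pick x | p (trans A s x)] is Some x then trans A s x else s.

Lemma spine_nextE s x : stable s -> p s -> p (trans A s x) -> spine_next s = trans A s x.
Proof.
rewrite /spine_next => ss ps px; case: pickP => [y py|/(_ x)]; last by rewrite px.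
by rewrite (stable_child ss ps px py).
Qed.

Hypothesis p_parent : forall s x, p (trans A s x) -> p s.

Lemma p_restr s v : p (restr A s v) -> p s.
Proof. by elim: v s => //= x v IH s /IH /p_parent. Qed.

Lemma iter_spine_next s v : stable s -> p (restr A s v) ->
  iter (size v) spine_next s = restr A s v.
Proof.
elim: v s => //= x v IH s ss pv; have px := p_restr pv.
by rewrite -(IH _ (stable_trans _ ss) pv) -(spine_nextE ss (p_parent px) px) -iterS iterSr.
Qed.

Lemma stable_spine k s : stable s -> p s -> exists v, size v = k /\ p (restr A s v).
Proof.
elim: k s => [|k IH] s ss ps; first by exists [::].
have [x px] := p_child ps; have [v [sv pv]] := IH _ (stable_trans x ss) px.
by exists (x :: v); rewrite /= sv.
Qed.

Lemma stable_spine_unique s u v : stable s -> size u = size v ->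
  p (restr A s u) -> p (restr A s v) -> u = v.
Proof.
elim: u v s => [|x u IH] [|y v] //= s ss [suv] pu pv.
have [px py] := (p_restr pu, p_restr pv).
have xy := stable_child ss (p_parent px) px py; rewrite -xy in pv *.
by rewrite (IH v _ (stable_trans _ ss) suv pu pv).
Qed.

End Persistent.
End Predicate.

Definition finitary_state k s := forall v, size v = k -> trivial_state A (restr A s v).

Lemma finitary_state_le k l s : k <= l -> finitary_state k s -> finitary_state l s.
Proof.
move=> kl f v sv; rewrite -(cat_take_drop k v) restr_cat.
by apply/trivial_restr/f; rewrite size_takel // sv.
Qed.

Lemma act_secw1 v s : act_word A (secw A v [:: s]) =1 out A (restr A s v).
Proof. by []. Qed.

Lemma finitary_state_word m s : finitary_state m s -> finitary_word A m [:: s].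
Proof. by move=> f u su y; rewrite act_secw1 f. Qed.

(** By boundedness the number of words leading to non-finitary states stabilises with depth. A deep
    non-finitary state thus has a single non-finitary path below it, and the states along this path
    are eventually periodic. *)
Lemma bounded_spinal_sections : bounded_aut A -> exists2 m, 0 < m &
  forall s v, size v = m -> let s' := restr A s v in
    finitary_word A m [:: s'] \/ exists u, spinal_word A m [:: s'] u.
Proof.
case=> C bdC; have [p pP] := classical_pred (fun s => ~ exists k, finitary_state k s).
have fin s : ~~ p s -> exists k, finitary_state k s.
  by move/negP => np; apply: NNPP => no; apply/np/pP.
have p_child s : p s -> exists x, p (trans A s x).
  move=> /pP ps; apply: NNPP => no; apply: ps.
  have ch x : exists k, finitary_state k (trans A s x).
    by apply: fin; apply/negP => px; apply: no; exists x.
  have [k kP] := finite_max ch (fun x n n' => @finitary_state_le n n' _).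
  by exists k.+1 => -[|x v] //= [/kP].
have p_parent s x : p (trans A s x) -> p s.
  move=> /pP px; apply/pP => -[k f]; apply: px; exists k => v sv.
  by apply: (finitary_state_le (leqnSn k) f (v := x :: v)); rewrite /= sv.
have cb : forall s n, count_to p n s <= C.
  apply: count_to_bounded => s n vs uvs H; apply: (bdC s n vs uvs) => v /H[sv /pP pv].
  by split=> // tv; apply: pv; exists 0 => -[].
have st s : exists M, forall k, M <= k -> forall j, count_to p (j + k) s = count_to p k s.
  have [M MP] := bounded_nondecreasing_stable (fun k => count_to_mono p_child k s) (cb s).
  exists M => k Mk j; rewrite (MP k) // MP //; exact: leq_trans Mk (leq_addl _ _).
have [M MP] := finite_max st (fun s n n' nn H k nk => H k (leq_trans nn nk)).
have fk s : exists k, p s \/ finitary_state k s.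
  by case ps: (p s); [exists 0; left | have [k f] := fin s (negbT ps); exists k; right].
have [K KP] := finite_max fk (fun s n n' nn H =>
  or_ind (@or_introl _ _) (fun f => or_intror (finitary_state_le nn f)) H).
(* A multiple of [F] is a period of every cycle of [spine_next]. The other factor leaves room for
   [M] letters to reach stability, [#|S|] letters to enter a cycle, and the common depth [K] of
   finitary states. *)
set F := (#|S|)`!; set m := F * (M + #|S| + K).+1.
have F0 : 0 < F by apply: fact_gt0.
have mge : M + #|S| + K < m by rewrite leq_pmull.
have finH s : ~~ p s -> finitary_state m s.
  move=> nps; case: (KP s) => [ps|f]; first by rewrite ps in nps.
  by apply: finitary_state_le f; lia.
exists m; first by lia.
move=> s v sv s'; case ps': (p s'); last first.
  by left; apply/finitary_state_word/finH; rewrite ps'.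
(* The first [M] letters lead to a stable state; the remaining ones number at least [#|S|], so [s']
   already lies on its cycle. *)
right; set v1 := take M v; set v2 := drop M v.
have sv1 : size v1 = M by rewrite size_takel // sv; lia.
have es' : s' = restr A (restr A s v1) v2 by rewrite -restr_cat cat_take_drop.
set s1 := restr A s v1 in es'.
have ss1 : stable p s1 by apply: stable_restr sv1; [exact: p_child | exact: MP].
have ss' : stable p s'.
  by rewrite es'; apply: (stable_restr p_child) (erefl _) => k; rewrite !ss1.
have per q : iter (q * F) (spine_next p) s' = s'.
  have e : iter (size v2) (spine_next p) s1 = s'.
    by rewrite es' iter_spine_next -?es'.
  elim: q => // q IH; rewrite mulSn iterD IH -e; apply: iter_fact_periodic.
  by rewrite size_drop sv; lia.
have [u [su pu]] := stable_spine p_child m ss' ps'.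
have eu : restr A s' u = s'.
  by rewrite -(iter_spine_next p_child p_parent ss' pu) su /m mulnC per.
exists u; split=> //; first by move=> y; rewrite act_secw1 eu.
move=> z sz zu; rewrite [secw _ _ _]/=; apply/finitary_state_word/finH/negP => pz.
by apply: zu; apply: (stable_spine_unique p_child p_parent ss') pz pu; rewrite sz.
Qed.

Lemma bounded_detection_depth : invertible_aut A -> bounded_aut A ->
  exists2 D, 0 < D & forall w,
    fixes_upto A (D * (trunc_log 2 (size w)).+1) w -> WP A w.
Proof.
(* With [l] the logarithm plus one: a first block makes all letters finitary or spinal, [l] halvings
   cost [2 * m] each, and [3 * m] remains at the end; [4 * m + 2 * m * l] is at most [6 * m * l]. *)
move=> inv /bounded_spinal_sections[m m0 mP]; exists (6 * m); first by lia.
move=> w fx; have [|w0] := posnP (size w); first by move/size0nil => ->.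
apply: (@WP_of_secm _ _ _ m) => [u su|v sv]; first by apply: fx; lia.
apply: (@spinal_length_WP _ _ _ m (size w) _ (trunc_log 2 (size w)).+1) => //.
- rewrite -(size_secw A v); apply: letters_spinal_length => s.
  by case/mem_secw => s0 [v0 [sv0 ->]]; apply: mP; rewrite sv0.
- exact/ltnW/trunc_log_ltn.
- by apply: fixes_upto_secw fx; rewrite sv; lia.
Qed.

End Counting.

(** * The automaton over the power alphabet *)

Section Power.
Variables (S X : finType) (A : automaton S X) (D : nat).
Implicit Types (s : S) (w : seq S) (v : D.-tuple X) (vs : seq (D.-tuple X)).

Lemma size_out_tuple s v : size (out A s v) == D.
Proof. by rewrite size_out size_tuple. Qed.

Definition power_aut : automaton S (D.-tuple X) :=
  Automaton (fun s v => restr A s v) (fun s v => Tuple (size_out_tuple s v)).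

Definition flat vs : seq X := flatten (map val vs).

Lemma flat_out s vs : flat (out power_aut s vs) = out A s (flat vs).
Proof. by elim: vs s => //= v vs IH s; rewrite /flat /= out_cat -IH. Qed.

Lemma flat_restr s vs : restr power_aut s vs = restr A s (flat vs).
Proof. by elim: vs s => //= v vs IH s; rewrite /flat /= restr_cat -IH. Qed.

Lemma flat_act w vs : flat (act_word power_aut w vs) = act_word A w (flat vs).
Proof. by elim: w vs => //= s w IH vs; rewrite IH flat_out. Qed.

Lemma size_flat vs : size (flat vs) = D * size vs.
Proof.
rewrite /flat; elim: vs => [|v vs IH] /=; first by rewrite muln0.
by rewrite size_cat IH size_tuple mulnS.
Qed.

Lemma flat_inj vs vs' : size vs = size vs' -> flat vs = flat vs' -> vs = vs'.
Proof.
elim: vs vs' => [|v vs IH] [|v' vs'] //= [sz] /eqP.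
rewrite /flat /= eqseq_cat ?size_tuple // => /andP[/eqP/val_inj-> /eqP e].
by rewrite (IH vs').
Qed.

Lemma flat_surj k u : size u = D * k -> exists vs, size vs = k /\ flat vs = u.
Proof.
elim: k u => [|k IH] u; first by rewrite muln0 => /size0nil->; exists [::].
rewrite mulnS => su; have st : size (take D u) == D by rewrite size_takel // su leq_addr.
have [|vs [svs evs]] := IH (drop D u); first by rewrite size_drop su addKn.
by exists (Tuple st :: vs); rewrite /= svs /flat /= -/(flat vs) evs cat_take_drop.
Qed.

Lemma power_invertible : invertible_aut A -> invertible_aut power_aut.
Proof. by move=> inv s v v' /(congr1 val) /= /(out_inj inv) /val_inj. Qed.

(** [flat] injects the words of length [n] over tuples into those of length [D * n] over [X], so the
    same constant serves. *)
Lemma power_bounded : bounded_aut A -> bounded_aut power_aut.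
Proof.
case=> C bd; exists C => s n vss uvss H.
rewrite -(size_map flat); apply: (bd s (D * n)).
  rewrite map_inj_in_uniq // => vs vs' /H[svs _] /H[svs' _].
  by apply: flat_inj; rewrite svs.
move=> u /mapP[vs /H[svs nt] ->]; rewrite size_flat svs; split=> // t; apply: nt => us.
by apply: flat_inj; rewrite ?size_out // flat_out flat_restr t.
Qed.

Lemma WP_power w : WP A w -> WP power_aut w.
Proof. by move=> tw vs; apply: flat_inj; rewrite ?size_act // flat_act tw. Qed.

(** A word whose length is not a multiple of [D] is padded by its first letter to length [D * k];
    the action respects prefixes. *)
Lemma power_fixes_upto k w : 0 < D ->
  fixes_upto power_aut k w -> fixes_upto A (D * k) w.
Proof.
move=> D0 fx [|x u] su; first by rewrite act_nil.
set u1 := x :: u; set pad := nseq (D * k - size u1) x.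
have [vs [svs evs]] : exists vs, size vs = k /\ flat vs = u1 ++ pad.
  by apply: flat_surj; rewrite size_cat size_nseq subnKC.
have := congr1 flat (fx vs _); rewrite flat_act evs act_cat svs => /(_ (leqnn _)) /eqP.
by rewrite eqseq_cat ?size_act // => /andP[/eqP].
Qed.

Lemma power_WP w : 0 < D -> WP power_aut w -> WP A w.
Proof.
move=> D0 tw u; apply: (@power_fixes_upto (size u)) => //.
by rewrite leq_pmull.
Qed.

End Power.

(** * Levels of sections *)

Section Levels.
Variables (S X : finType) (A : automaton S X) (t : pred S).
Hypothesis tP : forall s, t s <-> trivial_state A s.
Implicit Types (s : S) (x : X) (u v : seq S) (us : seq (seq S)).

Fixpoint nsec x u : seq S :=
  if u is s :: u' then
    if t (trans A s x) then nsec (outp A s x) u'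
    else trans A s x :: nsec (outp A s x) u'
  else [::].

Definition final x u := foldl (fun y s => outp A s y) x u.

Definition fixes_letter x us := all (fun u => final x u == x) us.

Definition sections x us := [seq v <- [seq nsec x u | u <- us] | v != [::]].

Definition next_level us := flatten [seq sections x us | x <- enum X].

Fixpoint passes k us :=
  if k is k'.+1 then all (fun x => fixes_letter x us) (enum X) && passes k' (next_level us)
  else true.

Lemma act_nsec x u y : act_word A u (x :: y) = final x u :: act_word A (nsec x u) y.
Proof.
elim: u x y => //= s u IH x y; rewrite IH; case: ifP => // /tP ts.
by rewrite [X in act_word A _ X]ts.
Qed.

(** Deleted letters and dropped empty sections act trivially, so passing to the next level loses
    nothing. *)
Lemma passesP k us : passes k us <-> forall u, u \in us -> fixes_upto A k u.
Proof.
elim: k us => [|k IH] us /=.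
  by split=> // _ u _ y; rewrite leqn0 => /nilP->; rewrite act_nil.
split=> [/andP[/allP fl /IH nx] u uus [|x y] sy|H]; first by rewrite act_nil.
  have /allP/(_ u uus)/eqP fx := fl x (mem_enum _ x).
  rewrite act_nsec fx; congr cons.
  have [->//|ne] := eqVneq (nsec x u) [::].
  apply: nx sy; apply/flattenP; exists (sections x us).
    by apply: map_f; rewrite mem_enum.
  by rewrite mem_filter ne map_f.
apply/andP; split.
  apply/allP => x _; apply/allP => u uus; apply/eqP.
  by have := H u uus [:: x] isT; rewrite act_nsec => -[].
apply/IH => v /flattenP[_ /mapP[x _ ->]].
rewrite mem_filter => /andP[_ /mapP[u uus ->]] y sy.
by have := H u uus (x :: y) sy; rewrite act_nsec => -[].
Qed.

Lemma passes_empty k us : enum X = [::] -> passes k us.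
Proof. by move=> X0; elim: k us => //= k IH us; rewrite X0 IH. Qed.

(** A potential: it counts the nontrivial sections, at depth [k], of all letters in the list. *)
Definition weight k us := \sum_(u <- us) \sum_(s <- u) count_to A (predC t) k s.

Lemma count_trivial k s : t s -> count_to A (predC t) k s = 0.
Proof.
elim: k s => [|k IH] s ts; first by rewrite count_to0 /= ts.
rewrite count_toS big1 // => x _; apply/IH/tP/trivial_trans; exact/tP.
Qed.

(** The letters read before a given letter permute [X]; as [x] runs through [X], that letter is
    therefore restricted at each element of [X] exactly once. *)
Lemma weight_next k us : invertible_aut A -> weight k (next_level us) <= weight k.+1 us.
Proof.
move=> inv; rewrite /weight /next_level big_flatten big_map big_enum /=.
have -> : \sum_(u <- us) \sum_(s <- u) count_to A (predC t) k.+1 s =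
  \sum_(u <- us) \sum_(s <- u) \sum_x count_to A (predC t) k (trans A s x).
  by apply: eq_bigr => u _; apply: eq_bigr => s _; rewrite count_toS.
(* For the induction, [f] stands for the injective action of the letters already read. *)
have sec_sum (f : X -> X) u : injective f ->
    \sum_x \sum_(s <- nsec (f x) u) count_to A (predC t) k s <=
    \sum_(s <- u) \sum_x count_to A (predC t) k (trans A s x).
  elim: u f => [|s u IH] f f_inj; first by rewrite big1 ?big_nil // => x; rewrite big_nil.
  rewrite big_cons [X in _ <= X + _](reindex_inj f_inj) /=.
  apply: leq_trans (leq_add (leqnn _) (IH (fun x => outp A s (f x)) _)); last first.
    by move=> x y /inv /f_inj.
  rewrite -big_split /=; apply: leq_sum => x _.
  by case: ifP => [/count_trivial->|_]; rewrite ?big_cons.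
apply: leq_trans (_ : \sum_x \sum_(u <- us) \sum_(s <- nsec x u) count_to A (predC t) k s <= _).
  apply: leq_sum => x _; rewrite /sections big_filter big_map.
  by rewrite big_mkcond /=; apply: leq_sum => u _; case: ifP.
by rewrite exchange_big /=; apply: leq_sum => u _; apply: (sec_sum id).
Qed.

Lemma weight_iter k us : invertible_aut A -> weight 0 (iter k next_level us) <= weight k us.
Proof.
move=> inv; elim: k us => // k IH us; rewrite iterSr.
exact: leq_trans (IH _) (weight_next _ _ inv).
Qed.

(** Tape length of the list: each word carries one separator. *)
Definition content us := \sum_(u <- us) (size u).+1.

(** The words of a new level are nonempty and free of trivial letters, so separators at most double
    the length. *)
Lemma content_next us : content (next_level us) <= 2 * weight 0 (next_level us).
Proof.
rewrite /content /weight big_distrr /= big_seq [X in _ <= X]big_seq.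
apply: leq_sum => v.
case/flattenP => [_ /mapP[x _ ->]]; rewrite mem_filter => /andP[v0 /mapP[u _ ev]].
suff -> : \sum_(s <- v) count_to A (predC t) 0 s = size v by case: v v0 {ev} => //= ; lia.
rewrite ev; elim: u x {ev} => [|s u IH] x /=; first by rewrite big_nil.
by case: ifP => ts; rewrite ?big_cons IH // count_to0 /= ts.
Qed.

Lemma content_iter C w : invertible_aut A ->
  (forall s k, count_to A (predC t) k s <= C) ->
  forall k, content (iter k next_level [:: w]) <= (2 * C + 1) * (size w).+1.
Proof.
(* The input is treated apart: it may contain trivial letters, which the weight does not see. *)
move=> inv bd [|k]; first by rewrite /content big_seq1; lia.
rewrite iterS; apply: leq_trans (content_next _) _; rewrite -iterS.
have : weight k.+1 [:: w] <= C * size w.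
  rewrite /weight big_seq1 -[size w]sum1_size big_distrr /=.
  by apply: leq_sum => s _; rewrite muln1.
have := weight_iter k.+1 [:: w] inv; nia.
Qed.

End Levels.

(** * Three-tape machines *)

Section ThreeTapes.
Variables (Sigma Q G : finType) (blank : G) (inp : Sigma -> G) (q0 : Q) (halt acc : pred Q).
(** [None] leaves the zipper syntactically unchanged, whereas rewriting the scanned symbol could add
    a blank to an empty list. *)
Definition action := option (G * move).
Variable delta : Q -> G -> G -> G -> Q * action * action * action.

Definition tape0 : 'I_3 := ord0.
Definition tape1 : 'I_3 := Ordinal (isT : 1 < 3).
Definition tape2 : 'I_3 := Ordinal (isT : 2 < 3).

Definition pick3 (T : Type) (a b c : T) (i : 'I_3) : T :=
  match val i with 0 => a | 1 => b | _ => c end.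

Definition written (g : G) (a : action) := if a is Some (g', _) then g' else g.
Definition direction (a : action) := if a is Some (_, m) then m else MoveN.

Definition machine : TM Sigma Q G 2 := MkTM blank inp q0 halt acc
  (fun q r =>
     let '(q', a0, a1, a2) := delta q (r tape0) (r tape1) (r tape2) in
     (q', [ffun i => written (r i) (pick3 a0 a1 a2 i)],
          [ffun i => direction (pick3 a0 a1 a2 i)])).

(* A tape is a pair (L, R): R is what the head reads from its position to the
   right, L what lies to its left, nearest cell first; both end in blanks. *)
Definition zipper := (seq G * seq G)%type.

Definition zip_act (T : zipper) (a : action) : zipper :=
  match a with
  | None => T
  | Some (g, MoveL) => (behead T.1, head blank T.1 :: g :: behead T.2)
  | Some (g, MoveN) => (T.1, g :: behead T.2)
  | Some (g, MoveR) => (g :: T.1, behead T.2)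
  end.

Definition zip_val (T : zipper) (k : int) : G :=
  match k with Posz j => nth blank T.2 j | Negz j => nth blank T.1 j end.

Definition zip_repr (f : int -> G) (h : int) (T : zipper) :=
  forall k, f (h + k)%R = zip_val T k.

Lemma zip_repr_head f h L R : zip_repr f h (L, R) -> f h = head blank R.
Proof. by move=> r; rewrite -[h in LHS]GRing.addr0 r /= nth0. Qed.

Lemma zip_repr_act f h T a : zip_repr f h T ->
  zip_repr (fun z => if z == h then written (f h) a else f z)
           (h + move_shift (direction a))%R (zip_act T a).
Proof.
move=> r k; rewrite -GRing.addrA r.
have -> (z : int) : (h + z == h)%R = (z == 0)%R by lia.
case: T r => L R r; case: a => [[g []]|] /=.
- case: k => [[|[|j]]|j] //=; rewrite nth_behead ?add0n //.
- by rewrite GRing.add0r; case: k => [[|j]|j] //=; rewrite nth_behead.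
- case: k => [j|[|j]] //=; rewrite ?nth_behead ?subn1 //.
- rewrite GRing.add0r; case: eqP => // ->.
  by rewrite (zip_repr_head r) /= nth0.
Qed.

(** Finite lists describe a tape only up to final blanks. *)
Definition zip_equiv (T T' : zipper) := forall k, zip_val T k = zip_val T' k.

Record zconfig := ZConfig { zstate : Q; ztape0 : zipper; ztape1 : zipper; ztape2 : zipper }.

Definition represents (c : config Q G 2) (a : zconfig) :=
  cfg_state c = zstate a /\
  forall i, zip_repr (cfg_tape c i) (cfg_head c i) (pick3 (ztape0 a) (ztape1 a) (ztape2 a) i).

(** The count is an upper bound, so costs compose by addition and can be relaxed freely. *)
Variant reaches (a a' : zconfig) (n : nat) : Prop :=
  Reaches of forall c, represents c a ->
    exists2 n' : nat, n' <= n & represents (tm_run machine n' c) a'.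

Lemma reaches_refl a n : reaches a a n.
Proof. by split=> c r; exists 0. Qed.

Lemma reaches_trans a2 a1 a3 n m :
  reaches a1 a2 n -> reaches a2 a3 m -> reaches a1 a3 (n + m).
Proof.
case=> r12 [r23]; split=> c /r12[n' le_n /r23[m' le_m r]]; exists (m' + n'); first by lia.
by rewrite /tm_run iterD.
Qed.

Lemma reaches_le a a' n m : n <= m -> reaches a a' n -> reaches a a' m.
Proof. by move=> le [r]; split=> c /r[n' le' ?]; exists n' => //; lia. Qed.

Lemma reaches_equiv a q T0 T1 T2 T0' T1' T2' n :
  reaches a (ZConfig q T0 T1 T2) n ->
  zip_equiv T0 T0' -> zip_equiv T1 T1' -> zip_equiv T2 T2' ->
  reaches a (ZConfig q T0' T1' T2') n.
Proof.
move=> [r] e0 e1 e2; split=> c /r[n' le [sc rc]]; exists n' => //; split=> // -[[|[|i]] lti] k;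
  by rewrite rc /pick3 /= (e0, e1, e2).
Qed.

Lemma reaches_equiv_start a q T0 T1 T2 T0' T1' T2' n :
  reaches (ZConfig q T0' T1' T2') a n ->
  zip_equiv T0 T0' -> zip_equiv T1 T1' -> zip_equiv T2 T2' ->
  reaches (ZConfig q T0 T1 T2) a n.
Proof.
move=> r e0 e1 e2; apply: (@reaches_trans (ZConfig q T0' T1' T2') _ _ 0 n) r.
exact: reaches_equiv (reaches_refl _ _) e0 e1 e2.
Qed.

Lemma zip_equiv_blankl L R : zip_equiv (rcons L blank, R) (L, R).
Proof. by case=> // j /=; rewrite nth_rcons; case: ltnP => // ge; rewrite if_same nth_default. Qed.

Lemma zip_equiv_blankr L R : zip_equiv (L, rcons R blank) (L, R).
Proof. by case=> // j /=; rewrite nth_rcons; case: ltnP => // ge; rewrite if_same nth_default. Qed.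

Lemma reaches_step q L0 R0 L1 R1 L2 R2 q' a0 a1 a2 a' n :
  ~~ halt q ->
  delta q (head blank R0) (head blank R1) (head blank R2) = (q', a0, a1, a2) ->
  reaches (ZConfig q' (zip_act (L0, R0) a0) (zip_act (L1, R1) a1) (zip_act (L2, R2) a2)) a' n ->
  reaches (ZConfig q (L0, R0) (L1, R1) (L2, R2)) a' n.+1.
Proof.
move=> hq dq [r]; split=> c [sc rc].
have [|n' le r'] := r (tm_step machine c); last first.
  by exists n'.+1 => //; rewrite /tm_run iterSr.
have h0 := zip_repr_head (rc tape0); have h1 := zip_repr_head (rc tape1).
have h2 := zip_repr_head (rc tape2).
rewrite /tm_step sc /= (negbTE hq) !ffunE h0 h1 h2 dq; split=> //= i.
have e : pick3 (zip_act (L0, R0) a0) (zip_act (L1, R1) a1) (zip_act (L2, R2) a2) i =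
    zip_act (pick3 (L0, R0) (L1, R1) (L2, R2) i) (pick3 a0 a1 a2 i).
  by case: i => -[|[|i]].
by rewrite e => k; rewrite -(zip_repr_act _ (rc i)) !ffunE.
Qed.

Lemma represents_init w :
  represents (tm_init machine w) (ZConfig q0 ([::], map inp w) ([::], [::]) ([::], [::])).
Proof.
by split=> // -[[|[|i]] lti] [k|k] //=; rewrite ?GRing.add0r /= ?nth_nil.
Qed.

End ThreeTapes.

Arguments reaches_refl {Sigma Q G blank inp q0 halt acc delta a n}.
Arguments reaches_trans {Sigma Q G blank inp q0 halt acc delta a2 a1 a3 n m}.
Arguments reaches_le {Sigma Q G blank inp q0 halt acc delta a a' n m}.
Arguments reaches_equiv {Sigma Q G blank inp q0 halt acc delta a q T0 T1 T2 T0' T1' T2' n}.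
Arguments reaches_equiv_start {Sigma Q G blank inp q0 halt acc delta a q T0 T1 T2 T0' T1' T2' n}.

(** * The word problem machine *)

(* Tape 0 holds the input, whose letters are the live counter cells; tape 1 the
   list of words being read; tape 2 the sections being produced.  [Transfer] moves
   tape 2 onto tape 1, [Count f seen] halves the counter from right to left, and
   [Scan x y ne] computes the sections at x: y is the image of x under the letters
   of the current word read so far, and ne records whether one of them left a
   nontrivial section. *)
Inductive phase (X : Type) :=
| CopyInput
| Transfer0
| Transfer
| Count0
| Count of bool & bool
| CountBack
| Scan of X & X & bool
| Rewind of X
| Erase
| Accept
| Reject.
Arguments CopyInput {X}. Arguments Transfer0 {X}. Arguments Transfer {X}.
Arguments Count0 {X}. Arguments Count {X}. Arguments CountBack {X}.
Arguments Erase {X}. Arguments Accept {X}. Arguments Reject {X}.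

Definition phase_code (X : Type) (q : phase X) :
    'I_8 + (bool * bool) + (X * X * bool) + X :=
  match q with
  | CopyInput => inl (inl (inl (inord 0)))
  | Transfer0 => inl (inl (inl (inord 1)))
  | Transfer => inl (inl (inl (inord 2)))
  | Count0 => inl (inl (inl (inord 3)))
  | Count f seen => inl (inl (inr (f, seen)))
  | CountBack => inl (inl (inl (inord 4)))
  | Scan x y ne => inl (inr (x, y, ne))
  | Rewind x => inr x
  | Erase => inl (inl (inl (inord 5)))
  | Accept => inl (inl (inl (inord 6)))
  | Reject => inl (inl (inl (inord 7)))
  end.

Definition phase_decode (X : Type)
    (c : 'I_8 + (bool * bool) + (X * X * bool) + X) : phase X :=
  match c with
  | inr x => Rewind x
  | inl (inr (x, y, ne)) => Scan x y ne
  | inl (inl (inr (f, seen))) => Count f seen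
  | inl (inl (inl i)) =>
      nth CopyInput [:: CopyInput; Transfer0; Transfer; Count0; CountBack; Erase; Accept; Reject] i
  end.

Lemma phase_codeK (X : Type) : cancel (@phase_code X) (@phase_decode X).
Proof. by case=> //=; rewrite inordK. Qed.

HB.instance Definition _ (X : eqType) :=
  Equality.copy (phase X) (can_type (@phase_codeK X)).
HB.instance Definition _ (X : choiceType) :=
  Choice.copy (phase X) (can_type (@phase_codeK X)).
HB.instance Definition _ (X : countType) :=
  Countable.copy (phase X) (can_type (@phase_codeK X)).
HB.instance Definition _ (X : finType) :=
  Finite.copy (phase X) (can_type (@phase_codeK X)).

Section WordProblemMachine.
Variables (S X : finType) (A : automaton S X) (t : pred S).

Definition symbol := option (S + bool).
Definition letter (s : S) : symbol := Some (inl s).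
Definition separator : symbol := Some (inr true).
Definition dead : symbol := Some (inr false).

Definition stay : action symbol := None.
Definition write (g : symbol) (m : move) : action symbol := Some (g, m).

Definition next_letter (x : X) : option X :=
  ohead (behead (drop (index x (enum X)) (enum X))).

(** [Count] accepts if it meets no live cell. At each separator [Scan] checks that the running
    letter has returned to [x]. Tape 1 is rewound for the next letter of [X] and erased after the
    last, while tape 2 accumulates the sections. *)
Definition wp_delta (q : phase X) (g0 g1 g2 : symbol) :
    phase X * action symbol * action symbol * action symbol :=
  match q with
  | CopyInput =>
      if g0 is Some _ then (CopyInput, write g0 MoveR, stay, write g0 MoveR)
      else (Transfer0, stay, stay, write separator MoveR)
  | Transfer0 => (Transfer, stay, write g1 MoveL, write g2 MoveL)
  | Transfer =>
      if g2 is Some _ then (Transfer, stay, write g2 MoveL, write None MoveL)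
      else (Count0, stay, write g1 MoveR, stay)
  | Count0 => (Count false false, write g0 MoveL, stay, stay)
  | Count f seen =>
      match g0 with
      | Some (inl _) => (Count (~~ f) true, write (if f then g0 else dead) MoveL, stay, stay)
      | Some (inr _) => (Count f seen, write g0 MoveL, stay, stay)
      | None => if seen then (CountBack, write g0 MoveR, stay, stay)
                else (Accept, stay, stay, stay)
      end
  | CountBack =>
      if g0 is Some _ then (CountBack, write g0 MoveR, stay, stay)
      else (if ohead (enum X) is Some x then Scan x x false else Accept, stay, stay, stay)
  | Scan x y ne =>
      match g1 with
      | Some (inl s) =>
          let s' := trans A s y in
          (Scan x (outp A s y) (ne || ~~ t s'), stay, write g1 MoveR,
           if t s' then stay else write (letter s') MoveR)
      | Some (inr _) =>
          if y == x then
            (Scan x x false, stay, write g1 MoveR, if ne then write g1 MoveR else stay)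
          else (Reject, stay, stay, stay)
      | None => (if next_letter x is Some _ then Rewind x else Erase, stay, write g1 MoveL, stay)
      end
  | Rewind x =>
      if g1 is Some _ then (Rewind x, stay, write g1 MoveL, stay)
      else (if next_letter x is Some x' then Scan x' x' false else Erase,
            stay, write g1 MoveR, stay)
  | Erase =>
      if g1 is Some _ then (Erase, stay, write None MoveL, stay)
      else (Transfer0, stay, stay, stay)
  | Accept | Reject => (q, stay, stay, stay)
  end.

Definition wp_halt : pred (phase X) :=
  fun q => match q with Accept | Reject => true | _ => false end.

Definition wp_acc : pred (phase X) := fun q => if q is Accept then true else false.

Notation reaches := (@reaches S (phase X) symbol None letter CopyInput wp_halt wp_acc wp_delta).
Notation blank := (None : symbol).
Notation zc := (@ZConfig (phase X) symbol).

(** * Phases of the machine and their running times *)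

Definition encode (u : seq S) : seq symbol := map letter u.
Definition encode_words (us : seq (seq S)) : seq symbol :=
  flatten [seq rcons (encode u) separator | u <- us].

Lemma size_encode_words us : size (encode_words us) = content us.
Proof.
rewrite /content /encode_words; elim: us => [|u us IH]; first by rewrite big_nil.
by rewrite big_cons -IH /= size_cat size_rcons size_map.
Qed.

Definition nonblank (g : symbol) := g != blank.

Lemma nonblank_encode_words us : all nonblank (encode_words us).
Proof.
apply/allP => g /flattenP[_ /mapP[u _ ->]]; rewrite mem_rcons inE.
by case/predU1P => [->|/mapP[s _ ->]].
Qed.

Lemma copy_input_reaches w L0 L2 :
  reaches (zc CopyInput (L0, encode w) ([::], [::]) (L2, [::]))
          (zc Transfer0 (catrev (encode w) L0, [::]) ([::], [::])
              (separator :: catrev (encode w) L2, [::])) (size w).+1.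
Proof.
elim: w L0 L2 => [|s w IH] L0 L2.
  apply: reaches_step => //. exact: reaches_refl.
by apply: reaches_step => //; apply: IH.
Qed.

(** In this and later loops, [behead L] with [head blank L] places the head on the nearest cell of
    [L]; this form also covers empty [L], where a blank is read and the loop ends. *)
Lemma transfer_loop T0 L ys : all nonblank L ->
  reaches (zc Transfer T0 ([::], blank :: ys) (behead L, [:: head blank L]))
          (zc Count0 T0 ([::], catrev L ys) ([::], [::])) (size L).+1.
Proof.
case: T0 => L0 R0; elim: L ys => [|c L IH] ys /=.
  move=> _; apply: reaches_step => //.
  apply: (reaches_equiv reaches_refl) => //=.
    exact: (zip_equiv_blankl _ [::]).
  exact: (zip_equiv_blankr _ _ [::]).
case: c => // c /= nL; apply: reaches_step => //.
apply: (reaches_equiv_start (IH (Some c :: ys) nL)) => //.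
exact: (zip_equiv_blankr _ _ [:: _]).
Qed.

Lemma transfer_reaches T0 L : all nonblank L ->
  reaches (zc Transfer0 T0 ([::], [::]) (L, [::]))
          (zc Count0 T0 ([::], rev L) ([::], [::])) (size L).+2.
Proof.
case: T0 => L0 R0 nL; apply: reaches_step => //.
apply: (reaches_equiv_start (transfer_loop _ [::] nL)) => //.
  exact: (zip_equiv_blankr _ _ [:: _]).
exact: (zip_equiv_blankr _ _ [:: _]).
Qed.

Definition live (g : symbol) := if g is Some (inl _) then true else false.

(** [f] tells whether the next live cell survives. Starting from [false] kills the first one, so
    halving rounds down and a counter with live cells always decreases. *)
Fixpoint halve (f : bool) (L : seq symbol) : seq symbol :=
  if L is g :: L' then
    if live g then (if f then g else dead) :: halve (~~ f) L' else g :: halve f L'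
  else [::].

Lemma size_halve f L : size (halve f L) = size L.
Proof. by elim: L f => //= g L IH f; case: ifP => _ /=; rewrite IH. Qed.

Lemma nonblank_halve f L : all nonblank L -> all nonblank (halve f L).
Proof.
elim: L f => //= g L IH f /andP[ng nL].
by case: ifP => _ /=; rewrite IH //; case: f; rewrite ?ng.
Qed.

Lemma count_halve f L :
  count live (halve f L) = if f then uphalf (count live L) else (count live L)./2.
Proof.
elim: L f => [|g L IH] f /=; first by case: f.
case lg: (live g) => /=; last by rewrite lg IH.
by case: f => /=; rewrite ?lg IH.
Qed.

Lemma count_loop f seen L R T1 T2 : all nonblank L ->
  reaches (zc (Count f seen) (behead L, head blank L :: R) T1 T2)
    (if seen || has live L then zc CountBack ([::], catrev (halve f L) R) T1 T2
     else zc Accept ([::], blank :: catrev (halve f L) R) T1 T2) (size L).+1.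
Proof.
case: T1 T2 => L1 R1 [L2 R2]; elim: L f seen R => [|g L IH] f seen R /=.
  move=> _; rewrite orbF; case: seen; apply: reaches_step => //=.
    apply: (reaches_equiv reaches_refl) => //.
    exact: (zip_equiv_blankl _ [::]).
  exact: reaches_refl.
case: g => // -[s|b] nL; apply: reaches_step => //=.
  by rewrite orbT; apply: (IH _ true).
exact: IH.
Qed.

Lemma countback_loop L R T1 T2 : all nonblank R ->
  reaches (zc CountBack (L, R) T1 T2)
    (zc (if ohead (enum X) is Some x then Scan x x false else Accept)
      (catrev R L, [::]) T1 T2) (size R).+1.
Proof.
case: T1 T2 => L1 R1 [L2 R2]; elim: R L => [|[g|//] R IH] L /= nR.
  by apply: reaches_step => //; exact: reaches_refl.
by apply: reaches_step => //; apply: IH.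
Qed.

Lemma count_reaches L T1 T2 : all nonblank L -> exists T0,
  reaches (zc Count0 (L, [::]) T1 T2)
    (if has live L then
       zc (if ohead (enum X) is Some x then Scan x x false else Accept)
         (halve false L, [::]) T1 T2
     else zc Accept T0 T1 T2) (2 * size L + 3).
Proof.
case: T1 T2 => L1 R1 [L2 R2] nL; eexists.
(* One step onto the counter, then one pass to the left and one back, each ending on a blank. *)
have -> : 2 * size L + 3 = ((size L).+1 + (size L).+1).+1 by lia.
apply: reaches_step => //.
apply: (@reaches_equiv_start _ _ _ _ _ _ _ _ _ _ _ _ _ _ (behead L, [:: head blank L])
  (L1, R1) (L2, R2)) => //; last exact: (zip_equiv_blankr _ _ [:: _]).
have := count_loop false false [::] (L1, R1) (L2, R2) nL.
rewrite orFb; case: ifP => _ r; last by apply: reaches_le r; lia.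
apply: (reaches_trans r).
have nh : all nonblank (catrev (halve false L) [::]).
  by rewrite -/(rev _) all_rev nonblank_halve.
have := countback_loop [::] (L1, R1) (L2, R2) nh.
by rewrite -!/(rev _) revK size_rev size_halve.
Qed.

Lemma scan_word_reaches T0 x y ne u L1 R1 L2 :
  reaches (zc (Scan x y ne) T0 (L1, encode u ++ R1) (L2, [::]))
          (zc (Scan x (final A y u) (ne || (nsec A t y u != [::]))) T0
              (catrev (encode u) L1, R1) (catrev (encode (nsec A t y u)) L2, [::]))
          (size u).
Proof.
case: T0 => L0 R0; elim: u y ne L1 L2 => [|s u IH] y ne L1 L2 /=.
  by rewrite orbF; exact: reaches_refl.
apply: reaches_step => //=.
case: ifP => ts /=; rewrite ?orbT ?orbF; first exact: IH.
exact: (IH _ true).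
Qed.

Definition rejects (a : zconfig (phase X) symbol) n :=
  exists T0 T1 T2, reaches a (zc Reject T0 T1 T2) n.

Lemma scan_words_reaches T0 x us L1 L2 :
  if fixes_letter A x us then
    reaches (zc (Scan x x false) T0 (L1, encode_words us) (L2, [::]))
            (zc (Scan x x false) T0 (catrev (encode_words us) L1, [::])
               (catrev (encode_words (sections A t x us)) L2, [::])) (content us)
  else rejects (zc (Scan x x false) T0 (L1, encode_words us) (L2, [::])) (content us).
Proof.
elim: us L1 L2 => [|u us IH] L1 L2 /=; first exact: reaches_refl.
have step1 := scan_word_reaches T0 x x false u L1 (separator :: encode_words us) L2.
have eR : encode_words (u :: us) = encode u ++ separator :: encode_words us.
  by rewrite /encode_words /= cat_rcons.
have ec : content (u :: us) = size u + (content us).+1.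
  by rewrite /content big_cons addSnnS.
rewrite eR ec; case: T0 step1 IH => L0 R0 step1 IH.
case: eqP => [fx|/eqP fx] /=; last first.
  exists (L0, R0); eexists; eexists; apply: (reaches_trans step1).
  apply: reaches_step => //=; first by rewrite (negbTE fx).
  exact: reaches_refl.
rewrite fx orFb in step1.
(* The separator is written only after a nonempty section, matching the filter in [sections]. *)
set L2' := if nsec A t x u != [::] then separator :: catrev (encode (nsec A t x u)) L2 else L2.
have step2 a n : reaches (zc (Scan x x false) (L0, R0)
     (separator :: catrev (encode u) L1, encode_words us) (L2', [::])) a n ->
   reaches (zc (Scan x x false) (L0, R0) (L1, encode u ++ separator :: encode_words us)
      (L2, [::])) a (size u + n.+1).
  move=> r; apply: (reaches_trans step1); apply: reaches_step => //=.
    by rewrite eqxx.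
  rewrite /L2' in r; case: eqP r => //= ->; exact.
have eL1 : catrev (encode u ++ separator :: encode_words us) L1 =
    catrev (encode_words us) (separator :: catrev (encode u) L1).
  by rewrite catrev_catl.
have eL2 : catrev (encode_words (sections A t x (u :: us))) L2 =
    catrev (encode_words (sections A t x us)) L2'.
  rewrite /sections /L2' /=; case: ifP => //= _.
  by rewrite /encode_words /= catrev_catl -cats1 catrev_catl.
rewrite eL1 eL2; have := IH (separator :: catrev (encode u) L1) L2'.
case: ifP => _; first exact: step2.
by case=> T0' [T1' [T2' r]]; exists T0', T1', T2'; apply: step2.
Qed.

Lemma rewind_loop T0 x L R T2 : all nonblank L ->
  reaches (zc (Rewind x) T0 (behead L, head blank L :: R) T2)
    (zc (if next_letter x is Some x' then Scan x' x' false else Erase) T0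
       ([::], catrev L R) T2) (size L).+1.
Proof.
case: T0 T2 => L0 R0 [L2 R2]; elim: L R => [|[g|//] L IH] R /= nL.
  apply: reaches_step => //; apply: (reaches_equiv reaches_refl) => //.
  exact: (zip_equiv_blankl _ [::]).
by apply: reaches_step => //; apply: IH.
Qed.

Lemma erase_loop T0 L T2 : all nonblank L ->
  reaches (zc Erase T0 (behead L, [:: head blank L]) T2)
    (zc Transfer0 T0 ([::], [::]) T2) (size L).+1.
Proof.
case: T0 T2 => L0 R0 [L2 R2]; elim: L => [|[g|//] L IH] /= nL.
  apply: reaches_step => //; apply: (reaches_equiv reaches_refl) => //.
  exact: (zip_equiv_blankr _ _ [::]).
apply: reaches_step => //; apply: (reaches_equiv_start (IH nL)) => //.
exact: (zip_equiv_blankr _ _ [:: _]).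
Qed.

Lemma next_letterE pre x xs : enum X = pre ++ x :: xs -> next_letter x = ohead xs.
Proof.
move=> e; have := enum_uniq X; rewrite e cat_uniq /= => /and3P[_ + _].
rewrite negb_or => /andP[xpre _].
by rewrite /next_letter e index_cat (negbTE xpre) /= eqxx addn0 drop_size_cat.
Qed.

(** Induction along the enumeration of [X]. Each letter pays for one scan of tape 1 and one return,
    made by [Rewind] except after the last letter, where [Erase] makes it. *)
Lemma scans_reach T0 us pre x xs L2 : enum X = pre ++ x :: xs ->
  let start := zc (Scan x x false) T0 ([::], encode_words us) (L2, [::]) in
  let n := (size xs).+1 * (2 * content us + 2) in
  if all (fun x => fixes_letter A x us) (x :: xs) then
    reaches start (zc Transfer0 T0 ([::], [::])
      (catrev (encode_words (flatten [seq sections A t y us | y <- x :: xs])) L2, [::])) n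
  else rejects start n.
Proof.
have nL := nonblank_encode_words us; rewrite -all_rev in nL.
case: T0 => L0 R0; elim: xs pre x L2 => [|x' xs IH] pre x L2 ex start n.
all: have := scan_words_reaches (L0, R0) x us [::] L2; rewrite /= -/start.
all: have nx := next_letterE ex.
all: case: ifP => /= _;
  last by (case=> T0' [T1' [T2' r]]; exists T0', T1', T2'; apply: reaches_le r; rewrite /n; nia).
  rewrite cats0 => r.
  have -> : n = content us + (content us).+2 by rewrite /n /=; lia.
  apply: (reaches_trans r); rewrite -/(rev _) /=.
  apply: reaches_step => //=; rewrite nx /=.
  have := erase_loop (L0, R0) (catrev (encode_words (sections A t x us)) L2, [::]) nL.
  rewrite size_rev size_encode_words => r'; apply: (reaches_equiv_start r') => //.
  exact: (zip_equiv_blankr _ _ [:: _]).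
move=> r.
set L2' := catrev (encode_words (sections A t x us)) L2 in r.
have {}r : reaches start (zc (Scan x' x' false) (L0, R0) ([::], encode_words us) (L2', [::]))
    (2 * content us + 2).
  have -> : 2 * content us + 2 = content us + (content us).+2 by lia.
  apply: (reaches_trans r); apply: reaches_step => //=; rewrite nx /=.
  have := rewind_loop (L0, R0) x [::] (L2', [::]) nL.
  rewrite nx /= size_rev size_encode_words -/(rev _) revK => r'.
  apply: (reaches_equiv_start r') => //.
  exact: (zip_equiv_blankr _ _ [:: _]).
have eL2 : catrev (encode_words (sections A t x us ++
    sections A t x' us ++ flatten [seq sections A t y us | y <- xs])) L2 =
    catrev (encode_words (flatten [seq sections A t y us | y <- x' :: xs])) L2'.
  by rewrite /L2' /encode_words map_cat flatten_cat catrev_catl.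
have -> : n = (2 * content us + 2) + (size xs).+1 * (2 * content us + 2) by rewrite /n mulSn.
have ex' : enum X = rcons pre x ++ x' :: xs by rewrite cat_rcons.
have := IH _ _ L2' ex'; rewrite eL2 /=; case: ifP => _ r'.
  exact: reaches_trans r r'.
by case: r' => T0' [T1' [T2' r']]; exists T0', T1', T2'; apply: reaches_trans r r'.
Qed.

(** The number of rounded-down halvings that bring [c] to zero. *)
Definition halvings c := if c == 0 then 0 else (trunc_log 2 c).+1.

Lemma halvings_half c : 0 < c -> halvings c = (halvings c./2).+1.
Proof.
rewrite /halvings; case: c => [|[|c]] // _.
by rewrite trunc_log2S.
Qed.

Definition reaches_verdict (a : zconfig (phase X) symbol) (b : bool) (n : nat) :=
  exists T0 T1 T2, reaches a (zc (if b then Accept else Reject) T0 T1 T2) n.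

(** Induction on the number of live cells. A round costs at most [B + 2] for the transfer,
    [2 * size L + 3] for the counter and [2 * B + 2] per letter of [X]; the extra round is the one
    that finds the counter dead and accepts. *)
Lemma rounds_reach B L us :
  all nonblank L -> (forall k, content (iter k (next_level A t) us) <= B) ->
  reaches_verdict (zc Transfer0 (L, [::]) ([::], [::]) (rev (encode_words us), [::]))
    (passes A t (halvings (count live L)) us)
    ((halvings (count live L)).+1 * (B + 2 * size L + 5 + #|X| * (2 * B + 2))).
Proof.
have [c] := ubnP (count live L); elim: c L us => // c IH L us /ltnSE-lec nL bd.
set cost := B + _ + _ + _.
have nus : all nonblank (rev (encode_words us)) by rewrite all_rev nonblank_encode_words.
have r1 := transfer_reaches (L, [::]) nus; rewrite revK size_rev size_encode_words in r1.
have [T0 r2] := count_reaches ([::], encode_words us) ([::], [::]) nL.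
have r12 := reaches_trans r1 r2; have b0 : content us <= B := bd 0.
move: r12; rewrite has_count; case: posnP => [->|c0] r12.
  exists T0, ([::], encode_words us), ([::], [::]); apply: reaches_le r12.
  by rewrite /halvings /= mul1n /cost; lia.
(* Over an empty alphabet every level passes and the machine accepts at once. *)
case eX: (enum X) r12 => [|x xs] /= r12.
  rewrite passes_empty //; do 3 eexists; apply: reaches_le r12.
  by apply: leq_trans (leq_pmull _ _); rewrite // /cost; lia.
have r3 := scans_reach (halve false L, [::]) us [::] (eX : enum X = [::] ++ _).
have sX : (size xs).+1 = #|X| by rewrite cardE eX.
have lecost : (content us).+2 + (2 * size L + 3) + #|X| * (2 * content us + 2) <= cost.
  by rewrite /cost; nia.
rewrite halvings_half //.
rewrite [passes _ _ _.+1 _]/= {1}eX.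
have hc : count live (halve false L) = (count live L)./2 by rewrite count_halve.
have := r3; rewrite /= sX; case: ifP => [|_] /=; last first.
  case=> T0' [T1' [T2' r3']]; exists T0', T1', T2'.
  apply: reaches_le (reaches_trans r12 r3').
  by apply: leq_trans lecost (leq_pmull _ _).
move=> /= _ r3'.
have [|||T0' [T1' [T2' r4]]] := IH (halve false L) (next_level A t us).
- by rewrite hc; lia.
- exact: nonblank_halve.
- by move=> k; rewrite -iterSr; apply: bd.
exists T0', T1', T2'.
rewrite size_halve -/cost hc in r4.
have eN : next_level A t us = flatten [seq sections A t y us | y <- x :: xs].
  by rewrite /next_level eX.
rewrite eN /rev in r4 *.
apply: reaches_le (reaches_trans r12 (reaches_trans r3' r4)).
by rewrite addnA [X in _ <= X]mulSn leq_add2r.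
Qed.

Definition wp_machine := machine blank letter CopyInput wp_halt wp_acc wp_delta.

Lemma wp_machine_decides C : invertible_aut A ->
  (forall s, t s <-> trivial_state A s) ->
  (forall s k, count_to A (predC t) k s <= C) ->
  (forall w, fixes_upto A (trunc_log 2 (size w)).+1 w -> WP A w) ->
  DTIME_star nlogn (WP A).
Proof.
move=> inv tP bC depth.
(* Chosen so that a round costs at most [K * n.+1], using [2 * n + 5 <= 7 * n.+1]. *)
pose K := (2 * C + 1) + 7 + #|X| * (2 * (2 * C + 1) + 2).
exists (phase X), symbol, 2, wp_machine, (6 * K + 4); split.
  by split => [s s' [] //|s].
move=> w; set n := size w; set B := (2 * C + 1) * n.+1.
have bd k : content (iter k (next_level A t) [:: w]) <= B by apply: content_iter.
have nL : all nonblank (rev (encode w)).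
  by rewrite all_rev all_map; apply/allP.
have [T0 [T1 [T2 r]]] := rounds_reach nL bd.
have r0 := copy_input_reaches w [::] [::].
have eL : separator :: catrev (encode w) [::] = rev (encode_words [:: w]).
  by rewrite /encode_words /= cats0 rev_rcons.
rewrite eL -/(rev _) in r0; have [{}r] := reaches_trans r0 r.
have cl : count live (rev (encode w)) = n.
  by rewrite count_rev count_map (eq_count (a2 := predT)) ?count_predT.
have [m le_m [st _]] : exists2 m : nat, _ & _ :=
  r (tm_init wp_machine w) (@represents_init _ _ _ _ _ _ _ _ _ w).
have wpE : passes A t (halvings n) [:: w] <-> WP A w.
  split=> [/(passesP tP)/(_ w (mem_head _ _))|tw]; last first.
    by apply/(passesP tP) => u; rewrite inE => /eqP-> y _.
  (* For empty input no level is checked, and the empty word is trivial; otherwise the number of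
     rounds is exactly the detection depth. *)
  rewrite /halvings; case: eqP => [/size0nil->|_] //; exact: depth.
rewrite cl size_rev size_map in st le_m.
exists m; split; last by rewrite st /=; case: ifP wpE.
apply: leq_trans le_m _; rewrite -/n /nlogn.
have lel : (halvings n).+1 <= trunc_log 2 n + 2 by rewrite /halvings; case: eqP; lia.
have leK : B + 2 * n + 5 + #|X| * (2 * B + 2) <= K * n.+1 by rewrite /B /K; nia.
apply: leq_trans (leq_add (leqnn _) (leq_mul lel leK)) _.
(* For [n <= 1] the logarithm vanishes and the additive constant pays. Otherwise it is at least 1,
   and the factors [trunc_log 2 n + 2] and [n.+1] are at most 3 and 2 times [trunc_log 2 n] and
   [n]. *)
have [n2|n1] := ltnP 1 n; last first.
  have -> : trunc_log 2 n = 0 by move: n1; case: (n) => [|[|]].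
  by nia.
have : 0 < trunc_log 2 n by rewrite trunc_log_gt0.
by nia.
Qed.

End WordProblemMachine.

Theorem mainTheorem10 (S X : finType) (A : automaton S X) :
  invertible_aut A -> minimal_aut A -> inverse_closed_aut A ->
  bounded_aut A ->
  DTIME_star nlogn (WP A).
Proof.
move=> inv _ _ bd.
have [D D0 depth] := bounded_detection_depth inv bd.
pose A' := power_aut A D.
have [t tP] := classical_pred (trivial_state A').
have [C bC] := power_bounded D bd.
have cC : forall s k, count_to A' (predC t) k s <= C.
  apply: count_to_bounded => s n vs uvs H; apply: (bC s n vs uvs) => v /H[sv /negP nt].
  by split=> // /tP.
have [|Q [G [k [M [c [wf dec]]]]]] := wp_machine_decides (power_invertible inv) tP cC.
  (* One letter of the power alphabet is [D] letters of [X], so depth [D] times the logarithm plus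
     one becomes that many levels. *)
  by move=> w fx; apply/WP_power/depth; apply: power_fixes_upto.
exists Q, G, k, M, c; split=> // w; have [m [le [hm acc]]] := dec w.
exists m; split=> //; split=> //; rewrite acc.
by split; [apply: power_WP | apply: WP_power].
Qed.
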